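(* We have the $\mathrm{des}$-Wilf equivalence $\underline{213}4\overset{\mathrm{des}}{\sim}\underline{132}4$.
   Context: $\mathfrak{S}_n$ is the set of permutations of $\{1,\ldots,n\}$ in one-line notation, and $\mathrm{des}(\pi)=|\{i\in[n-1]:\pi_i>\pi_{i+1}\}|$. An occurrence of the pattern $\underline{abc}d$ (where $abcd\in\mathfrak{S}_4$) in $\pi$ is a subsequence $\pi_i\pi_{i+1}\pi_{i+2}\pi_j$ with $j>i+2$ order-isomorphic to $abcd$. $\mathfrak{S}_n(\omega)$ is the set of permutations in $\mathfrak{S}_n$ with no occurrence of $\omega$. $\omega\overset{\mathrm{des}}{\sim}\omega'$ means $|\{\pi\in\mathfrak{S}_n(\omega):\mathrm{des}(\pi)=m\}|=|\{\pi\in\mathfrak{S}_n(\omega'):\mathrm{des}(\pi)=m\}|$ for all $n\ge1$ and $m\ge0$. *)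

(* Defs.v *)
From mathcomp Require Import all_boot all_fingroup.

Set Implicit Arguments.
Unset Strict Implicit.
Unset Printing Implicit Defensive.

(* A permutation of {1, ..., n} is represented by p : 'S_n, with positions and
   values both shifted down by one; only order comparisons of values and
   differences of positions matter below. *)

Definition des (n : nat) (p : 'S_n) : nat :=
  #|[set i : 'I_n | [exists j : 'I_n, (j == i.+1 :> nat) && (p j < p i)]]|.

Definition order_isomorphic (k : nat) (s t : k.-tuple nat) : bool :=
  [forall i : 'I_k, forall j : 'I_k,
     (tnth s i < tnth s j) == (tnth t i < tnth t j)].

(* The tuple [tuple a; b; c; d], the one-line notation of a permutation of
   {1, 2, 3, 4}, stands for the vincular pattern in which a, b, c are
   underlined: the first three letters of an occurrence are adjacent, the last
   one is anywhere to their right. *)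
Definition is_occurrence (w : 4.-tuple nat) (n : nat) (p : 'S_n)
    (i1 i2 i3 j : 'I_n) : bool :=
  [&& i2 == i1.+1 :> nat, i3 == i1.+2 :> nat, i1.+2 < j
    & order_isomorphic [tuple (p i1 : nat); (p i2 : nat); (p i3 : nat);
                              (p j : nat)] w].

Definition avoiders (n : nat) (w : 4.-tuple nat) : {set 'S_n} :=
  [set p : 'S_n | ~~ [exists i1 : 'I_n, exists i2 : 'I_n, exists i3 : 'I_n,
                      exists j : 'I_n, is_occurrence w p i1 i2 i3 j]].

Definition des_wilf_equivalent (w w' : 4.-tuple nat) : Prop :=
  forall n m : nat, 1 <= n ->
    #|[set p in avoiders n w | des p == m]| =
    #|[set p in avoiders n w' | des p == m]|.

(* Main.v *)
(* Cut a permutation at its largest letter, [L ++ m :: R].  An occurrence of a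
   pattern [abc-4] cannot use [m] among its first three letters, and [m] serves
   as the final [4] for every consecutive [abc] inside [L]; hence [L ++ m :: R]
   avoids [abc-4] iff [L] avoids the consecutive pattern [abc] and [R] avoids
   [abc-4].  Reverse-complement preserves descents and exchanges the consecutive
   patterns 213 and 132.  Applying it to [L] (relative to the letters of [L])
   and recursing on [R] is thus a descent-preserving involution which exchanges
   the two classes of avoiders. *)
Require Import Defs.
From mathcomp Require Import all_boot all_fingroup.
From mathcomp Require Import zify.

Set Implicit Arguments.
Unset Strict Implicit.
Unset Printing Implicit Defensive.

(** * Counting adjacent pairs, and descents of words *)

Fixpoint adjacent_count (T : Type) (r : rel T) (s : seq T) : nat :=
  if s is x :: s' then
    (if s' is y :: _ then nat_of_bool (r x y) else 0) + adjacent_count r s'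
  else 0.

(** The letter [x] closes the left piece and opens the right one, so each adjacent pair is counted
    exactly once. *)
Lemma adjacent_count_cat (T : Type) (r : rel T) s x t :
  adjacent_count r (s ++ x :: t) =
  adjacent_count r (rcons s x) + adjacent_count r (x :: t).
Proof.
elim: s => [|y s IHs] //.
by rewrite cat_cons rcons_cons /= IHs addnA; case: s {IHs}.
Qed.

Lemma adjacent_count_rev (T : Type) (r : rel T) s :
  adjacent_count r (rev s) = adjacent_count (fun x y => r y x) s.
Proof.
elim: s => [|x [|y s] IHs] //.
rewrite !rev_cons -cats1 cat_rcons adjacent_count_cat -rev_cons IHs /=.
by rewrite !addn0 addnC.
Qed.

Lemma eq_in_adjacent_count_map (T T' : eqType) (r : rel T) (r' : rel T')
    (f : T -> T') s :
  {in s &, forall x y, r' (f x) (f y) = r x y} ->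
  adjacent_count r' (map f s) = adjacent_count r s.
Proof.
elim: s => [|x s IHs] //= fE; rewrite IHs; last first.
  by move=> y z ys zs; rewrite fE // inE (ys, zs) orbT.
case: s fE {IHs} => [|y s] // fE.
by rewrite /= fE // !inE eqxx ?orbT.
Qed.

Lemma adjacent_countE (T : Type) (x0 : T) (r : rel T) s :
  adjacent_count r s =
  \sum_(i < size s) (i.+1 < size s) && r (nth x0 s i) (nth x0 s i.+1).
Proof.
elim: s => [|x s IHs]; first by rewrite big_ord0.
rewrite [LHS]/= IHs /= big_ord_recl /=; congr (_ + _).
by case: s {IHs}.
Qed.

Definition gtn_count := adjacent_count (fun x y => y < x).

(** The step up to [m] is never a descent; the step down from [m] is one as soon as a letter
    follows, whence the middle summand. *)
Lemma gtn_count_cat_max m s t :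
  all (gtn m) s -> all (gtn m) t ->
  gtn_count (s ++ m :: t) = gtn_count s + (0 < size t) + gtn_count t.
Proof.
move=> sm tm; rewrite /gtn_count adjacent_count_cat -addnA; congr (_ + _).
  elim: s sm => [|x s IHs] //= /andP[xm sm]; rewrite IHs //.
  by case: s {IHs} sm => //= _; rewrite ltnNge ltnW.
by case: t tm => [|y t] //= /andP[->].
Qed.

(** * Pattern avoidance in words and the cut at the largest letter *)

Section ConsecutivePatterns.

Variable P : nat -> nat -> nat -> bool.

Definition avoids_consecutive (s : seq nat) : Prop :=
  forall i, i.+2 < size s ->
  ~~ P (nth 0 s i) (nth 0 s i.+1) (nth 0 s i.+2).

Definition avoids_then_larger (s : seq nat) : Prop :=
  forall i j, i.+2 < j < size s ->
  ~~ [&& P (nth 0 s i) (nth 0 s i.+1) (nth 0 s i.+2),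
         nth 0 s i < nth 0 s j, nth 0 s i.+1 < nth 0 s j
       & nth 0 s i.+2 < nth 0 s j].

Lemma avoids_then_larger_cat_max m s t :
  all (gtn m) s -> all (gtn m) t ->
  avoids_then_larger (s ++ m :: t) <->
  avoids_consecutive s /\ avoids_then_larger t.
Proof.
move=> /(all_nthP 0) /= sm /(all_nthP 0) /= tm.
have nthl i : i < size s -> nth 0 (s ++ m :: t) i = nth 0 s i.
  by move=> lt_i; rewrite nth_cat lt_i.
have nthm : nth 0 (s ++ m :: t) (size s) = m by rewrite nth_cat ltnn subnn.
have nthr i : nth 0 (s ++ m :: t) ((size s).+1 + i) = nth 0 t i.
  by rewrite nth_cat addSnnS ifF ?addKn //; lia.
have size_st : size (s ++ m :: t) = (size s).+1 + size t.
  by rewrite size_cat /= addSnnS.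
have le_m j : j < (size s).+1 + size t -> nth 0 (s ++ m :: t) j <= m.
  case: (ltngtP j (size s)) => [lt_j _|lt_j lt_jn|-> _].
  - by rewrite nthl // ltnW //; apply: sm.
  - have -> : j = (size s).+1 + (j - (size s).+1) by lia.
    by rewrite nthr ltnW //; apply: tm; lia.
  - by rewrite nthm.
split=> [av|[avs avt] i j].
  split=> [i lt_i|i j lt_ij].
    (* Here the final larger letter is [m] itself, at position [size s]. *)
    have /av : i.+2 < size s < size (s ++ m :: t) by rewrite size_st; lia.
    rewrite nthm !nthl; try lia.
    by rewrite !sm ?andbT //; lia.
  have /av : ((size s).+1 + i).+2 < (size s).+1 + j < size (s ++ m :: t).
    by rewrite size_st; lia.
  by rewrite -!addnS !nthr.
rewrite size_st => lt_ij.
case: (ltnP i.+2 (size s)) => [lt_is|le_si].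
  by rewrite !(nthl i, nthl i.+1, nthl i.+2) ?(negPf (avs _ _)) //; lia.
case: (ltnP (size s) i) => [lt_si|le_is].
  have -> : i = (size s).+1 + (i - (size s).+1) by lia.
  have -> : j = (size s).+1 + (j - (size s).+1) by lia.
  by rewrite -!addnS !nthr; apply: avt; lia.
have {}le_m : nth 0 (s ++ m :: t) j <= m by apply: le_m; lia.
(* The window now straddles the cut, so one of its three letters is [m], and no letter of the word
   exceeds [m]. *)
have: [|| i == size s, i.+1 == size s | i.+2 == size s] by lia.
by case/or3P=> /eqP->; rewrite nthm (ltnNge m) le_m ?andbF.
Qed.

End ConsecutivePatterns.

(** * Reverse-complement relative to the letters of a word *)

Definition pat213 a b c := b < a < c.
Definition pat132 a b c := a < c < b.

(** For distinct letters, this exchanges the k-th smallest letter of [s] with the k-th largest; a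
    value outside [s] goes to the default [0]. *)
Definition complement_in (s : seq nat) (x : nat) : nat :=
  nth 0 (rev (sort leq s)) (index x (sort leq s)).

Definition reverse_complement (s : seq nat) : seq nat :=
  rev (map (complement_in s) s).

(** Lets a second reverse-complement use the same letter map as the first, since the letters have
    only been rearranged. *)
Lemma perm_complement_in s t :
  perm_eq s t -> complement_in s =1 complement_in t.
Proof.
move=> /(perm_sortP leq_total leq_trans anti_leq) Est x.
by rewrite /complement_in Est.
Qed.

Section ReverseComplement.

Variable s : seq nat.
Hypothesis uniq_s : uniq s.

Let u := sort leq s.
Let uniq_u : uniq u. Proof. by rewrite sort_uniq. Qed.
Let mem_u : u =i s. Proof. exact: mem_sort. Qed.
Let mem_nthP x : x \in s -> exists2 i, i < size u & nth 0 u i = x.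
Proof. by rewrite -mem_u => /(nthP 0). Qed.
Let nth_u_lt i j : i < size u -> j < size u -> (nth 0 u i < nth 0 u j) = (i < j).
Proof.
move=> lt_i lt_j; have su : sorted ltn u.
  by rewrite ltn_sorted_uniq_leq uniq_u sort_sorted //; apply: leq_total.
case: (ltngtP i j) => [lt_ij|lt_ji|->]; last by rewrite ltnn.
  by rewrite (sorted_ltn_nth ltn_trans).
by apply/negbTE; rewrite -leqNgt ltnW // (sorted_ltn_nth ltn_trans).
Qed.

Lemma complement_in_nth i :
  i < size u -> complement_in s (nth 0 u i) = nth 0 u (size u - i.+1).
Proof.
by move=> lt_i; rewrite /complement_in -/u index_uniq // nth_rev.
Qed.

Lemma complement_in_mem x : x \in s -> complement_in s x \in s.
Proof.
move=> /mem_nthP[i lt_i <-].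
have lt_i' : size u - i.+1 < size u by lia.
by rewrite complement_in_nth // -mem_u mem_nth.
Qed.

Lemma complement_inK : {in s, involutive (complement_in s)}.
Proof.
move=> x /mem_nthP[i lt_i <-].
by rewrite !complement_in_nth; first congr (nth 0 u _); lia.
Qed.

Lemma complement_in_ltn :
  {in s &, forall x y, (complement_in s x < complement_in s y) = (y < x)}.
Proof.
move=> x y /mem_nthP[i lt_i <-] /mem_nthP[j lt_j <-].
by rewrite !complement_in_nth // !nth_u_lt //; lia.
Qed.

Lemma perm_reverse_complement : perm_eq (reverse_complement s) s.
Proof.
rewrite perm_rev.
have uniq_c : uniq (map (complement_in s) s).
  rewrite map_inj_in_uniq // => x y xs ys Exy.
  by rewrite -(complement_inK xs) Exy complement_inK.
apply: uniq_perm => //.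
have sub_c : {subset map (complement_in s) s <= s}.
  by move=> _ /mapP[x xs ->]; apply: complement_in_mem.
(* An injective map of a finite set into itself is onto. *)
by have [_] := uniq_min_size uniq_c sub_c (eq_leq (esym (size_map _ _))).
Qed.

Lemma all_reverse_complement a : all a (reverse_complement s) = all a s.
Proof. exact: perm_all perm_reverse_complement. Qed.

Lemma reverse_complementK : reverse_complement (reverse_complement s) = s.
Proof.
rewrite {1}/reverse_complement.
rewrite (eq_map (perm_complement_in perm_reverse_complement)).
rewrite /reverse_complement map_rev revK -map_comp.
by apply: map_id_in => x xs /=; rewrite complement_inK.
Qed.

(** Reversal and complement each exchange ascents with descents, so together they preserve
    descents. *)
Lemma gtn_count_reverse_complement :
  gtn_count (reverse_complement s) = gtn_count s.
Proof.
rewrite /gtn_count /reverse_complement adjacent_count_rev.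
by apply: eq_in_adjacent_count_map => x y xs ys; rewrite complement_in_ltn.
Qed.

Lemma avoids_reverse_complement (P Q : nat -> nat -> nat -> bool) :
  {in s & &, forall a b c,
    Q (complement_in s c) (complement_in s b) (complement_in s a) = P a b c} ->
  avoids_consecutive P s -> avoids_consecutive Q (reverse_complement s).
Proof.
move=> QP av i; rewrite size_rev size_map => lt_i.
rewrite !nth_rev ?size_map; try lia.
rewrite !(nth_map 0); try lia.
(* The window at [i] of the image is the complemented window at [size s - i.+3], read backwards. *)
have -> : size s - i.+1 = (size s - i.+3).+2 by lia.
have -> : size s - i.+2 = (size s - i.+3).+1 by lia.
have lt_j : (size s - i.+3).+2 < size s by lia.
by rewrite QP ?mem_nth ?av // ltnW // ltnW.
Qed.

Lemma avoids_213_reverse_complement :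
  avoids_consecutive pat213 s -> avoids_consecutive pat132 (reverse_complement s).
Proof.
apply: avoids_reverse_complement => a b c a_s b_s c_s.
by rewrite /pat132 /pat213 !complement_in_ltn // andbC.
Qed.

Lemma avoids_132_reverse_complement :
  avoids_consecutive pat132 s -> avoids_consecutive pat213 (reverse_complement s).
Proof.
apply: avoids_reverse_complement => a b c a_s b_s c_s.
by rewrite /pat132 /pat213 !complement_in_ltn // andbC.
Qed.

End ReverseComplement.

(** * The involution on words, by recursion along the cut at the maximum *)

(** Strong induction on length. Distinctness makes all other letters strictly smaller than the
    maximum. Only the right part carries an induction hypothesis, as the left block is transformed
    in one go. *)
Lemma cat_max_ind (Q : seq nat -> Prop) :
  Q [::] ->
  (forall s m t, all (gtn m) s -> all (gtn m) t -> uniq s -> uniq t ->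
     Q t -> Q (s ++ m :: t)) ->
  forall s, uniq s -> Q s.
Proof.
move=> Q0 Qcat s; have [n] := ubnP (size s); elim: n s => // n IHn s lt_sn us.
case: (posnP (size s)) => [/size0nil-> //|s_gt0].
have ms : \max_(x <- s) x \in s.
  elim: s s_gt0 {lt_sn us} => // x s IHs _; rewrite big_cons.
  case: s IHs => [|y s] IHs; first by rewrite big_nil maxn0 mem_head.
  by rewrite inE; case: leqP (IHs isT) => [_ ->|]; rewrite ?eqxx ?orbT.
have le_m x : x \in s -> x <= \max_(x <- s) x.
  by move=> xs; apply: (@leq_bigmax_seq _ s predT id).
move: (\max_(x <- s) x) ms le_m => m /splitPr Es le_m.
case: Es lt_sn us le_m {s_gt0} => L R.
rewrite size_cat cat_uniq /= negb_or addnS => lt_n /and4P[uL /andP[mL _] mR uR] le_m.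
apply: Qcat => //; last exact: IHn (leq_ltn_trans (leq_addl _ _) lt_n) uR.
  apply/allP=> x xL; rewrite /= ltn_neqAle le_m ?mem_cat ?xL // andbT.
  by apply: contraNneq mL => <-.
apply/allP=> x xR; rewrite /= ltn_neqAle le_m ?mem_cat ?inE ?xR ?orbT // andbT.
by apply: contraNneq mR => <-.
Qed.

(* [n] is fuel; [size s <= n] suffices for it not to run out. *)
Fixpoint flip_blocks (n : nat) (s : seq nat) : seq nat :=
  if n is n'.+1 then
    if s is [::] then [::] else
    let m := \max_(x <- s) x in
    reverse_complement (take (index m s) s) ++
      m :: flip_blocks n' (drop (index m s).+1 s)
  else [::].

Lemma flip_blocks_nil n : flip_blocks n [::] = [::].
Proof. by case: n. Qed.

Lemma flip_blocks_cat_max n m s t :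
  all (gtn m) s -> all (gtn m) t ->
  flip_blocks n.+1 (s ++ m :: t) = reverse_complement s ++ m :: flip_blocks n t.
Proof.
move=> sm tm.
have Emax : \max_(x <- s ++ m :: t) x = m.
  apply/eqP; rewrite eqn_leq; apply/andP; split.
    apply/bigmax_leqP_seq => x; rewrite mem_cat inE => /or3P[xs|/eqP->|xt] _ //.
      by apply: ltnW; apply: (allP sm).
    by apply: ltnW; apply: (allP tm).
  by apply: (@leq_bigmax_seq _ _ predT id); rewrite ?mem_cat ?mem_head ?orbT.
have Eidx : index m (s ++ m :: t) = size s.
  rewrite index_cat ifN /= ?eqxx ?addn0 //.
  by apply/negP=> /(allP sm) /=; rewrite ltnn.
(* One unfolding for any nonempty word: [s] may be empty, so the head of [s ++ m :: t] is not
   known. *)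
have -> u : 0 < size u -> flip_blocks n.+1 u =
    let m := \max_(x <- u) x in
    reverse_complement (take (index m u) u) ++
      m :: flip_blocks n (drop (index m u).+1 u) by case: u.
  by rewrite /= Emax Eidx take_size_cat // -(cat_rcons m s)
    drop_size_cat ?size_rcons.
by rewrite size_cat addnS.
Qed.

Lemma perm_flip_blocks n s :
  uniq s -> size s <= n -> perm_eq (flip_blocks n s) s.
Proof.
move=> us; elim/cat_max_ind: us n => [|L m R Lm Rm uL uR IHR] n.
  by rewrite !flip_blocks_nil.
case: n => [|n]; first by rewrite size_cat addnS.
rewrite size_cat addnS ltnS => le_n.
rewrite flip_blocks_cat_max // perm_cat ?perm_reverse_complement //.
by rewrite perm_cons IHR // (leq_trans (leq_addl _ _) le_n).
Qed.

Lemma all_flip_blocks a n s :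
  uniq s -> size s <= n -> all a (flip_blocks n s) = all a s.
Proof. by move=> us le_sn; apply: perm_all (perm_flip_blocks us le_sn). Qed.

Lemma flip_blocksK n s :
  uniq s -> size s <= n -> flip_blocks n (flip_blocks n s) = s.
Proof.
move=> us; elim/cat_max_ind: us n => [|L m R Lm Rm uL uR IHR] n.
  by rewrite !flip_blocks_nil.
case: n => [|n]; first by rewrite size_cat addnS.
rewrite size_cat addnS ltnS => le_n.
have le_Rn : size R <= n := leq_trans (leq_addl _ _) le_n.
(* Both parts keep their letters, hence [m] is still the maximum between them and the second pass
   cuts at the same place. *)
rewrite !flip_blocks_cat_max ?all_reverse_complement ?all_flip_blocks //.
by rewrite reverse_complementK // IHR.
Qed.

Lemma gtn_count_flip_blocks n s :
  uniq s -> size s <= n -> gtn_count (flip_blocks n s) = gtn_count s.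
Proof.
move=> us; elim/cat_max_ind: us n => [|L m R Lm Rm uL uR IHR] n.
  by rewrite !flip_blocks_nil.
case: n => [|n]; first by rewrite size_cat addnS.
rewrite size_cat addnS ltnS => le_n.
have le_Rn : size R <= n := leq_trans (leq_addl _ _) le_n.
rewrite flip_blocks_cat_max //.
rewrite !gtn_count_cat_max ?all_reverse_complement ?all_flip_blocks //.
rewrite gtn_count_reverse_complement // IHR //.
(* The descent leaving [m] survives because the right part keeps its length. *)
by rewrite (perm_size (perm_flip_blocks uR le_Rn)).
Qed.

Lemma avoids_flip_blocks (P Q : nat -> nat -> nat -> bool) n s :
  (forall t, uniq t ->
     avoids_consecutive P t -> avoids_consecutive Q (reverse_complement t)) ->
  uniq s -> size s <= n ->
  avoids_then_larger P s -> avoids_then_larger Q (flip_blocks n s).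
Proof.
move=> PQ us; elim/cat_max_ind: us n => [|L m R Lm Rm uL uR IHR] n.
  by rewrite flip_blocks_nil => _ _ i j /=; rewrite andbF.
case: n => [|n]; first by rewrite size_cat addnS.
rewrite size_cat addnS ltnS => le_n.
have le_Rn : size R <= n := leq_trans (leq_addl _ _) le_n.
rewrite flip_blocks_cat_max //.
move=> /(avoids_then_larger_cat_max P Lm Rm)[avL avR].
apply/avoids_then_larger_cat_max; rewrite ?all_reverse_complement ?all_flip_blocks //.
by split; [apply: PQ | apply: IHR].
Qed.

(** * Translation between permutations and words *)

Definition word (n : nat) (p : 'S_n) : seq nat :=
  [seq nat_of_ord (p i) | i <- enum 'I_n].

Lemma size_word n (p : 'S_n) : size (word p) = n.
Proof. by rewrite size_map size_enum_ord. Qed.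

Lemma nth_word n (p : 'S_n) (i : 'I_n) : nth 0 (word p) i = p i.
Proof. by rewrite (nth_map i) ?size_enum_ord // nth_ord_enum. Qed.

Lemma word_inj n : injective (@word n).
Proof.
by move=> p q Epq; apply/permP=> i; apply: val_inj; rewrite /= -!nth_word Epq.
Qed.

Lemma word_uniq n (p : 'S_n) : uniq (word p).
Proof.
by rewrite map_inj_uniq ?enum_uniq // => i j /val_inj /perm_inj.
Qed.

(** Needed to read a flipped word back as a permutation. *)
Lemma perm_wordP n (s : seq nat) :
  reflect (exists p : 'S_n, s = word p) (perm_eq s (iota 0 n)).
Proof.
have E (p : 'S_n) : [tuple tnth (iota_tuple n 0) (p i) | i < n] = word p :> seq _.
  apply: eq_map => i; by rewrite (tnth_nth 0) /= nth_iota.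
by apply: (iffP (@tuple_permP _ _ s (iota_tuple n 0))) => -[p ->]; exists p.
Qed.

Lemma gtn_count_word n (p : 'S_n) : gtn_count (word p) = des p.
Proof.
rewrite /gtn_count (adjacent_countE 0) size_word /des -sum1dep_card.
rewrite [RHS]big_mkcond /=; apply: eq_bigr => i _.
case: (ltnP i.+1 n) => [lt_i|le_ni] /=.
  rewrite nth_word (nth_word p (Ordinal lt_i)).
  (* The only candidate for [j] is [i.+1]. *)
  suff -> : [exists j : 'I_n, (j == i.+1 :> nat) && (p j < p i)] =
            (p (Ordinal lt_i) < p i) by case: ifP.
  apply/existsP/idP => [[j /andP[/eqP Ej]]|lt_p].
    by congr (p _ < _); apply: val_inj.
  by exists (Ordinal lt_i); rewrite eqxx.
by case: existsP => // -[j /andP[/eqP Ej _]]; have := ltn_ord j; lia.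
Qed.

Lemma order_isomorphic_nth (a b c d a' b' c' d' : nat) :
  order_isomorphic [tuple a; b; c; d] [tuple a'; b'; c'; d'] =
  [forall i : 'I_4, forall j : 'I_4,
     (nth 0 [:: a; b; c; d] i < nth 0 [:: a; b; c; d] j) ==
     (nth 0 [:: a'; b'; c'; d'] i < nth 0 [:: a'; b'; c'; d'] j)].
Proof.
by apply: eq_forallb => i; apply: eq_forallb => j; rewrite !(tnth_nth 0).
Qed.

Lemma order_isomorphic_2134 a b c d :
  order_isomorphic [tuple a; b; c; d] [tuple 2; 1; 3; 4] =
  [&& pat213 a b c, a < d, b < d & c < d].
Proof.
rewrite order_isomorphic_nth /pat213; apply/idP/idP.
  move=> /forallP H.
  have {}H i j := eqP (forallP (H i) j).
  (* The comparisons [b < a], [a < c] and [c < d] form a chain that determines the whole order. *)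
  have := H (inord 1) (inord 0); have := H (inord 0) (inord 2).
  have := H (inord 2) (inord 3).
  by rewrite !inordK //=; lia.
move=> H; apply/forallP=> -[[|[|[|[|//]]]] ?];
  by apply/forallP=> -[[|[|[|[|//]]]] ?] /=; lia.
Qed.

Lemma order_isomorphic_1324 a b c d :
  order_isomorphic [tuple a; b; c; d] [tuple 1; 3; 2; 4] =
  [&& pat132 a b c, a < d, b < d & c < d].
Proof.
rewrite order_isomorphic_nth /pat132; apply/idP/idP.
  move=> /forallP H.
  have {}H i j := eqP (forallP (H i) j).
  (* Here the chain is [a < c < b < d]. *)
  have := H (inord 0) (inord 2); have := H (inord 2) (inord 1).
  have := H (inord 1) (inord 3).
  by rewrite !inordK //=; lia.
move=> H; apply/forallP=> -[[|[|[|[|//]]]] ?];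
  by apply/forallP=> -[[|[|[|[|//]]]] ?] /=; lia.
Qed.

Lemma mem_avoiders n (w : 4.-tuple nat) (P : nat -> nat -> nat -> bool) (p : 'S_n) :
  (forall a b c d, order_isomorphic [tuple a; b; c; d] w =
                   [&& P a b c, a < d, b < d & c < d]) ->
  reflect (avoids_then_larger P (word p)) (p \in avoiders n w).
Proof.
move=> wP; rewrite inE; apply: (iffP idP) => [av i j|av].
  rewrite size_word => /andP[lt_ij lt_jn].
  have lt_i2 : i.+2 < n by lia.
  have lt_i1 : i.+1 < n by lia.
  have lt_i : i < n by lia.
  rewrite (nth_word p (Ordinal lt_i)) (nth_word p (Ordinal lt_i1)).
  rewrite (nth_word p (Ordinal lt_i2)) (nth_word p (Ordinal lt_jn)).
  apply: contra av; rewrite -wP => iso.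
  apply/existsP; exists (Ordinal lt_i); apply/existsP; exists (Ordinal lt_i1).
  apply/existsP; exists (Ordinal lt_i2); apply/existsP; exists (Ordinal lt_jn).
  by rewrite /is_occurrence /= !eqxx lt_ij.
apply/existsP=> -[i1 /existsP[i2 /existsP[i3 /existsP[j]]]].
move=> /and4P[/eqP E2 /eqP E3 lt_ij]; rewrite wP.
have /av : i1.+2 < j < size (word p) by rewrite size_word lt_ij ltn_ord.
by rewrite -E3 -E2 !nth_word => /negP.
Qed.

(** * Comparing the numbers of avoiders *)

(** An involution is injective. The map lives on words, so the hypothesis names the image
    permutation [q] through its word. *)
Lemma leq_card_flip n (X Y : {set 'S_n}) :
  (forall p q : 'S_n, p \in X -> word q = flip_blocks n (word p) -> q \in Y) ->
  #|X| <= #|Y|.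
Proof.
move=> XY; rewrite !cardE -(size_map (flip_blocks n \o @word n) (enum X)).
rewrite -(size_map (@word n) (enum Y)); apply: uniq_leq_size.
  rewrite map_inj_in_uniq ?enum_uniq // => p q _ _ /= Epq; apply: word_inj.
  have flipK (r : 'S_n) : flip_blocks n (flip_blocks n (word r)) = word r.
    by rewrite flip_blocksK ?word_uniq ?size_word.
  by rewrite -flipK Epq flipK.
move=> _ /mapP[p pX ->]; rewrite mem_enum in pX.
have /perm_wordP[q Eq] : perm_eq (flip_blocks n (word p)) (iota 0 n).
  apply: perm_trans (perm_flip_blocks (word_uniq p) _) _; rewrite ?size_word //.
  by apply/perm_wordP; exists p.
by rewrite /= Eq map_f // mem_enum (XY p).
Qed.

(** Stated for abstract [P] and [Q] so that it serves in both directions: two injections give the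
    equality without showing either one onto. *)
Lemma leq_card_avoiders n m (w w' : 4.-tuple nat)
    (P Q : nat -> nat -> nat -> bool) :
  (forall a b c d, order_isomorphic [tuple a; b; c; d] w =
                   [&& P a b c, a < d, b < d & c < d]) ->
  (forall a b c d, order_isomorphic [tuple a; b; c; d] w' =
                   [&& Q a b c, a < d, b < d & c < d]) ->
  (forall t, uniq t ->
     avoids_consecutive P t -> avoids_consecutive Q (reverse_complement t)) ->
  #|[set p in avoiders n w | des p == m]| <=
  #|[set p in avoiders n w' | des p == m]|.
Proof.
move=> wP wQ PQ; apply: leq_card_flip => p q.
rewrite inE => /andP[pw /eqP <-] Eq.
have size_p : size (word p) <= n by rewrite size_word.
have uniq_p := word_uniq p.
rewrite inE; apply/andP; split; last first.
  by rewrite -!gtn_count_word Eq gtn_count_flip_blocks.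
apply/(mem_avoiders _ wQ); rewrite Eq.
by apply: avoids_flip_blocks PQ _ _ _ => //; apply/(mem_avoiders _ wP).
Qed.

Theorem theorem3p5 :
  des_wilf_equivalent [tuple 2; 1; 3; 4] [tuple 1; 3; 2; 4].
Proof.
move=> n m _; apply/eqP; rewrite eqn_leq; apply/andP; split.
  apply: leq_card_avoiders order_isomorphic_2134 order_isomorphic_1324 _.
  exact: avoids_213_reverse_complement.
apply: leq_card_avoiders order_isomorphic_1324 order_isomorphic_2134 _.
exact: avoids_132_reverse_complement.
Qed.
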